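(* Let $g:[0,\infty)\to[0,\infty)$ be non-decreasing with $g(0)=0$. For online single-machine preemptive scheduling with the Generalized Completion Time objective, HDF (at every time process at full rate a pending job of maximum density $\delta_j=w_j/p_j$) is an optimal online algorithm for the fractional objective, i.e. its fractional cost $\sum_j\delta_j\int_{r_j}^\infty g(t)x_j(t)\,dt$ equals the minimum fractional cost over all unit-speed schedules on every instance; and for every $\epsilon>0$ it is $(1+\epsilon)$-speed $\frac{1+\epsilon}{\epsilon}$-competitive for the integral objective $\sum_j w_j g(C_j)$.
   Context: Job $j$ has release time $r_j\ge0$, processing time $p_j>0$, weight $w_j>0$, revealed at $r_j$. A schedule of speed $s$ assigns rates $x_j(t)\ge0$, $x_j(t)=0$ for $t<r_j$, $\sum_j x_j(t)\le s$; $C_j$ is the first time with $\int_{r_j}^{C_j}x_j=p_j$. An online algorithm (speed 1) is $\alpha$-speed $\beta$-competitive if its cost is at most $\beta$ times the minimum cost over offline schedules of speed $1/\alpha$. *)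

(* Defs.v *)
From mathcomp Require Import all_boot all_order all_algebra finmap.
From mathcomp Require Import all_classical all_reals all_analysis.

Set Implicit Arguments.
Unset Strict Implicit.
Unset Printing Implicit Defensive.

Import Order.TTheory GRing.Theory Num.Theory.
Import numFieldNormedType.Exports.

Local Open Scope fset_scope.
Local Open Scope classical_set_scope.
Local Open Scope ring_scope.

(* Jobs carry arbitrary labels in nat, so that a label reveals nothing about
   the number or the labels of the jobs still to come. *)
Record instance (R : realType) := Instance {
  jobs : {fset nat};
  rel : nat -> R;
  proc : nat -> R;
  wt : nat -> R;
  rel_ge0 : forall j, j \in jobs -> 0 <= rel j;
  proc_gt0 : forall j, j \in jobs -> 0 < proc j;
  wt_gt0 : forall j, j \in jobs -> 0 < wt j }.

Section Scheduling.
Variable R : realType.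
Implicit Types (I : instance R) (x : nat -> R -> R) (s t : R) (j : nat).

Local Notation mu := (@lebesgue_measure R).

(* [x j t] is the rate given to job [j] at time [t]; rates of labels outside
   [jobs I] are never used. *)
Definition schedule s I x : Prop :=
  [/\ forall j, j \in jobs I -> measurable_fun setT (x j),
      forall j t, j \in jobs I -> 0 <= x j t,
      forall j t, j \in jobs I -> t < rel I j -> x j t = 0 &
      forall t, \sum_(j <- jobs I) x j t <= s].

Definition work I x j t : \bar R :=
  (\int[mu]_(u in `[rel I j, t]) (x j u)%:E)%E.

Definition completed_by I x j : set R :=
  [set C | rel I j <= C /\ work I x j C = (proc I j)%:E].

Definition completes I x : Prop :=
  forall j, j \in jobs I -> completed_by I x j !=set0.

(* For a schedule the infimum is a minimum, since [work] is continuous in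
   time; it is only meaningful when [completed_by I x j] is nonempty. *)
Definition completion_time I x j : R := inf (completed_by I x j).

Definition density I j : R := wt I j / proc I j.

Definition frac_cost (g : R -> R) I x : \bar R :=
  (\sum_(j <- jobs I)
     (density I j)%:E * \int[mu]_(t in `[rel I j, +oo[) (g t * x j t)%:E)%E.

Definition gct_cost (g : R -> R) I x : \bar R :=
  (\sum_(j <- jobs I) wt I j * g (completion_time I x j))%:E.

(* The offline benchmark ranges over the schedules in which every job has a
   (finite) completion time. Processing a job beyond its size is allowed; it
   never lowers a cost. *)
Definition opt (cost : instance R -> (nat -> R -> R) -> \bar R) s I : \bar R :=
  ereal_inf [set cost I x | x in [set x | schedule s I x /\ completes I x]].

Definition revealed I t j : bool := (j \in jobs I) && (rel I j <= t).

Definition same_history t I I' : Prop :=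
  forall j, revealed I t j = revealed I' t j /\
    (revealed I t j ->
      [/\ rel I j = rel I' j, proc I j = proc I' j & wt I j = wt I' j]).

(* The rates at time [t] only depend on the jobs released up to time [t]. *)
Definition online_algorithm (A : instance R -> nat -> R -> R) : Prop :=
  (forall I, schedule 1 I (A I)) /\
  (forall I I' t, same_history t I I' ->
     forall j, revealed I t j -> A I j t = A I' j t).

(* [completes I (A I)] puts [A I] among the schedules over which [opt] takes
   the infimum, which is therefore a minimum, attained by [A I]. *)
Definition optimal cost (A : instance R -> nat -> R -> R) : Prop :=
  forall I, completes I (A I) /\ cost I (A I) = opt cost 1 I.

Definition competitive cost (alpha beta : R)
    (A : instance R -> nat -> R -> R) : Prop :=
  forall I, completes I (A I) /\
    (cost I (A I) <= beta%:E * opt cost (alpha^-1) I)%E.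

Definition pending I x t j : bool :=
  revealed I t j && (work I x j t < (proc I j)%:E)%E.

(* Ties between pending jobs of maximum density may be broken arbitrarily,
   and differently at different times. *)
Definition hdf_at I x t : Prop :=
  (exists j, [/\ pending I x t j,
       forall i, pending I x t i -> density I i <= density I j,
       x j t = 1 &
       forall i, i \in jobs I -> i != j -> x i t = 0])
  \/ (forall i, i \in jobs I -> ~~ pending I x t i /\ x i t = 0).

Definition HDF (A : instance R -> nat -> R -> R) : Prop :=
  forall I t, hdf_at I (A I) t.

End Scheduling.

(* Main.v *)
(* For a density threshold [d] and a time [t], let [u] be the last time before
   [t] at which HDF has no pending job denser than [d]. Such jobs released
   before [u] are finished by HDF at time [t]; on those released after [u], HDF
   works at full rate during [u, t], while a schedule of speed [s] spends at
   most [s (t - u)] on them. Summing over thresholds (Abel summation) bounds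
   density-weighted remaining amounts at time [t]:
   - with [s = 1], HDF minimizes the fractional weight remaining at every time,
     and writing [g] as an integral of indicators of rays gives optimality for
     the fractional cost;
   - with [s < 1], the total size of the jobs dense enough and released after
     [u] is at least [t - u], so a schedule of speed [s] leaves a fraction at
     least [1 - s] of it unprocessed. Hence the weight of the jobs unfinished by
     HDF is at most [1 / (1 - s)] times the weight unfinished by the other
     schedule, at every time; a second Abel summation, over completion times,
     compares the integral costs.
   HDF exists: serve the jobs by decreasing priority, giving each the first
   [proc I j] units of time after its release that no job of higher priority
   occupies. The part of this construction before [t] only involves the jobs
   released up to [t], so it is online. *)
Require Import Defs.
From mathcomp Require Import all_boot all_order all_algebra finmap.
From mathcomp Require Import all_classical all_reals all_analysis.
From mathcomp Require Import measurable_realfun ring lra.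
(* Restores [rel] as the release time, shadowed by the type of relations. *)
Import Defs.

Set Implicit Arguments.
Unset Strict Implicit.
Unset Printing Implicit Defensive.

Import Order.TTheory GRing.Theory Num.Theory.
Import numFieldNormedType.Exports.

Local Open Scope ring_scope.

(** * Work received by a job as a function of time *)

Lemma integral_cst_itv (R : realType) (s a b : R) : a <= b ->
  (\int[@lebesgue_measure R]_(u in `]a, b]) (cst s u)%:E = (s * (b - a))%:E)%E.
Proof.
move=> ab.
transitivity (\int[@lebesgue_measure R]_(u in `]a, b]) (cst s%:E u))%E.
  exact: eq_integral.
rewrite integral_cst//= lebesgue_measure_itv/= lte_fin.
case: ltP => ab'; first by rewrite -EFinB -EFinM.
by rewrite (@le_anti _ _ a b) ?ab// subrr mulr0 mule0.
Qed.

Section Work.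
Variables (R : realType) (I : instance R) (x : nat -> R -> R) (s : R).
Hypothesis xP : schedule s I x.
Local Notation mu := (@lebesgue_measure R).
Implicit Types (a b t u v : R) (j : nat).

Definition rwork j t : R := fine (work I x j t).

Lemma rate_ge0 j t : j \in jobs I -> 0 <= x j t.
Proof. by case: xP => _ + _ _; exact. Qed.

Lemma rate_sum_le (Q : pred nat) t : \sum_(j <- jobs I | Q j) x j t <= s.
Proof.
case: xP => _ x0 _ /(_ t); apply: le_trans.
rewrite big_seq_cond [leRHS]big_seq_cond big_mkcond [leRHS]big_mkcond/=.
apply: ler_sum => j _; rewrite andbT.
by case: ifPn => [/andP[-> _]//|_]; case: ifPn => // /x0; exact.
Qed.

Lemma rate_le j t : j \in jobs I -> x j t <= s.
Proof.
move=> jI; apply: le_trans (rate_sum_le (pred1 j) t).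
rewrite big_mkcond (bigD1_seq j) ?fset_uniq//= eqxx lerDl.
by rewrite big1// => i /negbTE ->.
Qed.

Lemma speed_ge0 : 0 <= s.
Proof. by apply: le_trans (rate_sum_le pred0 0); rewrite big_pred0. Qed.

Lemma measurable_rate (D : set R) j : measurable D -> j \in jobs I ->
  measurable_fun D (fun t => (x j t)%:E).
Proof.
move=> mD jI; apply/measurable_EFinP; case: xP => + _ _ _ => /(_ _ jI).
exact: measurable_funS.
Qed.

(* The rate vanishes before the release time, so the lower bound of the
   integral is immaterial. *)
Lemma workE j t : j \in jobs I ->
  work I x j t = (\int[mu]_(u in `]-oo, t]) (x j u)%:E)%E.
Proof.
move=> jI; rewrite /work [LHS]integral_mkcond [RHS]integral_mkcond.
apply: eq_integral => u _; rewrite !patchE !mem_setE !in_itv/=.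
case: (leP (rel I j) u) => //= ur; case: ifP => // _.
by case: xP => _ _ /(_ _ _ jI ur) ->.
Qed.

Lemma frac_integralE (h : R -> R) j : j \in jobs I ->
  (\int[mu]_(t in `[rel I j, +oo[) (h t * x j t)%:E
   = \int[mu]_t (h t * x j t)%:E)%E.
Proof.
move=> jI; rewrite [LHS]integral_mkcond.
apply: eq_integral => u _; rewrite !patchE !mem_setE !in_itv/= andbT.
case: (leP (rel I j) u) => //= ur.
by case: xP => _ _ /(_ _ _ jI ur) -> _; rewrite mulr0.
Qed.

Lemma work_split j a b : j \in jobs I -> a <= b ->
  work I x j b = (work I x j a + \int[mu]_(u in `]a, b]) (x j u)%:E)%E.
Proof.
move=> jI ab; rewrite !workE//.
have -> : (`]-oo, b] = `]-oo, a] `|` `]a, b] :> set R)%classic.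
  by rewrite -itv_bndbnd_setU// bnd_simp.
rewrite ge0_integral_setU//=.
- by apply: (@measurable_rate _ j) => //; exact: measurableU.
- by move=> u _; rewrite lee_fin rate_ge0.
- apply/disj_setPS => u/= []; rewrite !in_itv/= => ua /andP[au _].
  by rewrite ltNge ua in au.
Qed.

Lemma integral_rate_ge0 (D : set R) j : j \in jobs I ->
  (0 <= \int[mu]_(u in D) (x j u)%:E)%E.
Proof. by move=> jI; apply: integral_ge0 => u _; rewrite lee_fin rate_ge0. Qed.

Lemma integral_rate_le j a b : j \in jobs I -> a <= b ->
  (\int[mu]_(u in `]a, b]) (x j u)%:E <= (s * (b - a))%:E)%E.
Proof.
move=> jI ab.
have -> : (s * (b - a))%:E = (\int[mu]_(u in `]a, b]) (cst s u)%:E)%E.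
  exact/esym/integral_cst_itv.
apply: ge0_le_integral => //=.
- by move=> u _; rewrite lee_fin rate_ge0.
- exact: (@measurable_rate _ j).
- by move=> u _; rewrite lee_fin rate_le.
Qed.

Lemma work_before j t : j \in jobs I -> t <= rel I j -> work I x j t = 0%E.
Proof.
move=> jI tr; rewrite /work.
have [tr'|rt] := ltP t (rel I j).
  by rewrite set_itv_ge ?integral_set0// bnd_simp -ltNge.
by rewrite (@le_anti _ _ t (rel I j)) ?tr// set_itv1 integral_set1.
Qed.

Lemma work_rwork j t : j \in jobs I -> work I x j t = (rwork j t)%:E.
Proof.
move=> jI; rewrite /rwork fineK//.
have [tr|/ltW rt] := leP t (rel I j); first by rewrite work_before.
rewrite (work_split jI rt) work_before// add0e.
rewrite ge0_fin_numE ?integral_rate_ge0//.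
by apply: le_lt_trans (integral_rate_le jI rt) _; rewrite ltry.
Qed.

Lemma rwork_ge0 j t : j \in jobs I -> 0 <= rwork j t.
Proof. by move=> jI; rewrite /rwork fine_ge0// integral_rate_ge0. Qed.

Lemma rwork_before j t : j \in jobs I -> t <= rel I j -> rwork j t = 0.
Proof. by move=> jI tr; rewrite /rwork work_before. Qed.

Lemma rwork_split j a b : j \in jobs I -> a <= b ->
  (rwork j b)%:E = ((rwork j a)%:E + \int[mu]_(u in `]a, b]) (x j u)%:E)%E.
Proof. by move=> jI ab; rewrite -!work_rwork//; exact: work_split. Qed.

Lemma rwork_le j a b : j \in jobs I -> a <= b -> rwork j a <= rwork j b.
Proof.
by move=> jI ab; rewrite -lee_fin (rwork_split jI ab) leeDl ?integral_rate_ge0.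
Qed.

(** Continuity of work in time, in the form used at suprema and infima of sets of times. *)
Lemma rwork_lip j a b : j \in jobs I -> a <= b ->
  rwork j b <= rwork j a + s * (b - a).
Proof.
move=> jI ab; rewrite -lee_fin (rwork_split jI ab) EFinD leeD2l//.
exact: integral_rate_le.
Qed.

Lemma sum_rwork (Q : pred nat) u t : u <= t ->
  (forall j, j \in jobs I -> Q j -> u <= rel I j) ->
  (\sum_(j <- jobs I | Q j) rwork j t)%:E =
  (\int[mu]_(v in `]u, t]) (\sum_(j <- jobs I | Q j) x j v)%:E)%E.
Proof.
move=> ut Qu.
(* Rates of labels outside [jobs I] are arbitrary; [y] replaces them by 0 so that every summand is
   measurable and nonnegative. *)
pose y j v := if j \in jobs I then (x j v)%:E else 0%E.
transitivity (\int[mu]_(v in `]u, t])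
    (\sum_(j <- [seq j <- jobs I | Q j]) y j v)%E)%E; last first.
  apply: eq_integral => v _.
  rewrite -[RHS](sumEFin _ _ (x ^~ v)) -[RHS]big_filter.
  apply: eq_big_seq => j; rewrite mem_filter => /andP[_ jI].
  by rewrite /y jI.
rewrite ge0_integral_sum//.
- rewrite -(sumEFin _ _ (rwork ^~ t)) -big_filter.
  apply: eq_big_seq => j; rewrite mem_filter => /andP[Qj jI].
  rewrite (rwork_split jI ut).
  rewrite rwork_before ?Qu// add0e; apply: eq_integral => v _.
  by rewrite /y jI.
- move=> j; rewrite /y; case: (boolP (j \in jobs I)) => jI; last first.
    exact: measurable_cst.
  exact: measurable_rate.
- move=> j v _; rewrite /y; case: ifPn => // jI.
  by rewrite lee_fin rate_ge0.
Qed.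

Lemma sum_rwork_le (Q : pred nat) u t : u <= t ->
  (forall j, j \in jobs I -> Q j -> u <= rel I j) ->
  \sum_(j <- jobs I | Q j) rwork j t <= s * (t - u).
Proof.
move=> ut Qu; rewrite -lee_fin (sum_rwork ut)//.
have -> : (s * (t - u))%:E = (\int[mu]_(v in `]u, t]) (cst s v)%:E)%E.
  exact/esym/integral_cst_itv.
apply: ge0_le_integral => //=.
- move=> v _; rewrite lee_fin big_seq_cond sumr_ge0// => j /andP[jI _].
  exact: rate_ge0.
- apply/measurable_EFinP; pose y j v := if j \in jobs I then x j v else 0.
  apply: (@eq_measurable_fun _ _ _ _ _
    (fun v => \sum_(j <- [seq j <- jobs I | Q j]) y j v)) => [v _|].
    rewrite -[RHS]big_filter; apply: eq_big_seq => j.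
    by rewrite mem_filter /y => /andP[_ ->].
  apply: measurable_sum => j; rewrite /y; case: (boolP (j \in jobs I)) => jI.
    by apply/measurable_EFinP; exact: measurable_rate.
  exact: measurable_cst.
- by move=> v _; rewrite lee_fin rate_sum_le.
Qed.

End Work.

(** * Abel summation over thresholds *)

Lemma seq_argmin (R : realType) (T : eqType) (k : T -> R) (i : T) (r : seq T) :
  exists2 i0, i0 \in i :: r & forall l, l \in i :: r -> k i0 <= k l.
Proof.
elim: r i => [|a r IH] i; first by exists i => [|l]; rewrite ?inE// => /eqP ->.
have [i0 i0r min0] := IH a; have [ki|/ltW ki] := leP (k i) (k i0).
  exists i => [|l]; first by rewrite inE eqxx.
  by rewrite inE => /predU1P[-> //|/min0]; exact: le_trans.
exists i0 => [|l]; first by rewrite inE i0r orbT.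
by rewrite inE => /predU1P[-> //|/min0].
Qed.

(** A nonnegative [f] that is nondecreasing in the key [k] is a nonnegative combination of
    indicators of [v < k i], so testing these suffices. The keys will be densities, then completion
    times. *)
Lemma threshold_sum_ge0 (R : realType) (T : eqType) (r : seq T)
    (k c f : T -> R) :
  (forall v, 0 <= \sum_(i <- r | v < k i) c i) ->
  {in r, forall i, 0 <= f i} ->
  {in r &, forall i l, k i <= k l -> f i <= f l} ->
  0 <= \sum_(i <- r) f i * c i.
Proof.
have [n] := ubnP (size r); elim: n r f => // n IH [|i r] f sz c0 f0 fk.
  by rewrite big_nil.
have [i0 i0r min0] := seq_argmin k i r.
set s := i :: r in i0r min0 sz c0 f0 fk *.
(* The lowest value [f i0] is split off; the items of minimal key then drop out, which shortens the
   list. *)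
have -> : \sum_(l <- s) f l * c l = f i0 * \sum_(l <- s) c l +
    \sum_(l <- [seq l <- s | k i0 < k l]) (f l - f i0) * c l.
  rewrite big_filter big_distrr/= [X in _ + X]big_mkcond -big_split/=.
  apply: eq_big_seq => l ls; case: ltP => kl; first by ring.
  suff -> : f l = f i0 by ring.
  by apply/le_anti; rewrite !fk// min0.
apply: addr_ge0.
  (* The threshold [k i0 - 1] lies below every key, so it yields the whole sum. *)
  rewrite mulr_ge0 ?f0//; have := c0 (k i0 - 1); congr (0 <= _).
  rewrite big_seq_cond [RHS]big_seq_cond; apply: eq_bigl => l.
  by case: (boolP (l \in s)) => //= /min0; lra.
apply: IH => [|v|l|l m].
- rewrite size_filter; rewrite ltnS in sz; apply: leq_trans sz.
  rewrite -(count_predC (fun l => k i0 < k l) s) -[ltnLHS]addn0 ltn_add2l.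
  by rewrite -has_count; apply/hasP; exists i0 => //=; rewrite ltxx.
- have := c0 (Num.max v (k i0)); congr (0 <= _).
  by rewrite big_filter_cond; apply: eq_bigl => l; rewrite gt_max andbC.
- by rewrite mem_filter => /andP[/ltW kl ls]; rewrite subr_ge0 fk.
- rewrite !mem_filter => /andP[_ ls] /andP[_ ms] klm.
  by rewrite lerB// fk.
Qed.

(** * HDF schedules: no overprocessing, busy periods, completion *)

Section HDFSchedule.
Variables (R : realType) (I : instance R) (H : nat -> R -> R).
Hypotheses (HP : schedule 1 I H) (hdfH : forall t, hdf_at I H t).
Local Notation mu := (@lebesgue_measure R).
Implicit Types (a b d t u v : R) (j : nat).

Lemma pendingE t j : pending I H t j =
  [&& j \in jobs I, rel I j <= t & rwork I H j t < proc I j].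
Proof.
rewrite /pending /revealed -andbA; case: (boolP (j \in jobs I)) => //= jI.
by rewrite (work_rwork HP)// lte_fin.
Qed.

Lemma hdf_idle t j : j \in jobs I -> ~~ pending I H t j -> H j t = 0.
Proof.
move=> jI npj; case: (hdfH t) => [[i [pi _ _ +]]|/(_ _ jI)[]//].
by apply=> //; apply: contraNneq npj => ->.
Qed.

(** After the last time [sup E] at which at most [proc I j] has been done, the job is not pending
    and gets nothing; continuity gives the bound at [sup E] itself. *)
Lemma rwork_le_proc j t : j \in jobs I -> rwork I H j t <= proc I j.
Proof.
move=> jI; have p0 : 0 < proc I j := proc_gt0 jI.
pose E := [set v | v <= t /\ rwork I H j v <= proc I j]%classic.
have E0 : E (Num.min t (rel I j)).
  split; first by rewrite ge_min lexx.
  by rewrite (rwork_before) ?ge_min ?lexx ?orbT// ltW.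
have supE : has_sup E by split; [exists (Num.min t (rel I j))|exists t => v []].
have ct : sup E <= t.
  by apply: ge_sup => [|v []//]; exists (Num.min t (rel I j)).
have Ec v : E v -> v <= sup E by exact: (ub_le_sup supE.2).
have wc : rwork I H j (sup E) <= proc I j.
  apply/ler_addgt0Pr => e e0; have [v [vt wv] cv] := sup_adherent e0 supE.
  have := rwork_lip HP jI (Ec _ (conj vt wv)); lra.
rewrite -lee_fin (rwork_split HP jI ct) integral0_eq ?adde0 ?lee_fin//.
move=> v /=; rewrite in_itv/= => /andP[cv vt]; rewrite hdf_idle//.
rewrite pendingE; apply/negP => /and3P[_ _ /ltW wv].
by have := Ec _ (conj vt wv); rewrite leNgt cv.
Qed.

(* [u] is the last time up to which some instant sees no pending job of
   density above [d]: after it the machine only serves such jobs. *)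
Lemma hdf_busy d t : exists u, [/\ u <= t,
  forall j, j \in jobs I -> d < density I j -> rel I j < u ->
    proc I j <= rwork I H j t &
  \sum_(j <- jobs I | (d < density I j) && (u <= rel I j)) rwork I H j t
    = t - u].
Proof.
pose E := [set v | v <= t /\
  forall j, d < density I j -> ~~ pending I H v j]%classic.
(* The time [-1] precedes every release, so nothing is pending there. *)
have E0 : E (Num.min t (-1)).
  split=> [|j _]; first by rewrite ge_min lexx.
  rewrite pendingE; apply/negP => /and3P[/rel_ge0 r0].
  by rewrite le_min => /andP[_ ?]; lra.
have supE : has_sup E by split; [exists (Num.min t (-1))|exists t => v []].
have ut : sup E <= t by apply: ge_sup => [|v []//]; exists (Num.min t (-1)).
have Ec v : E v -> v <= sup E by exact: (ub_le_sup supE.2).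
(* Some instant of [E] lies after the release of such a job, which is not pending there and hence
   finished. *)
have finished j v : j \in jobs I -> d < density I j -> rel I j < sup E ->
    sup E <= v -> proc I j <= rwork I H j v.
  move=> jI dj ru uv; have /sup_adherent/(_ supE) : 0 < sup E - rel I j by lra.
  rewrite subKr => -[a Ea ra].
  apply: le_trans (rwork_le HP jI (le_trans (Ec _ Ea) uv)).
  by have := Ea.2 _ dj; rewrite pendingE jI (ltW ra)/= -leNgt.
exists (sup E); split=> [//|j jI dj ru|]; first exact: finished.
apply: EFin_inj; rewrite (sum_rwork HP ut) => [|j _ /andP[]//].
rewrite -[RHS]mul1e -EFinM -(integral_cst_itv _ ut).
apply: eq_integral => v; rewrite inE/= in_itv/= => /andP[uv vt].
(* Past [sup E] a job denser than [d] is pending, so the served job is denser than [d] as well;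
   being unfinished, it was released at or after [sup E], and the rates in the sum add up to 1. *)
have : ~ E v by move=> /Ec; rewrite leNgt uv.
move=> /not_andP[//|/existsNP[i /not_implyP[di /negP]]]; rewrite negbK => pi.
case: (hdfH v) => [[j [pj maxj Hj Hj0]]|idle]; last first.
  by have := pi; rewrite pendingE => /andP[/idle[]]; rewrite pi.
have /and3P[jI rv wv] :
    [&& j \in jobs I, rel I j <= v & rwork I H j v < proc I j].
  by rewrite -pendingE.
have dj : d < density I j := lt_le_trans di (maxj _ pi).
have uj : sup E <= rel I j.
  rewrite leNgt; apply/negP => /(finished _ _ jI dj)/(_ (ltW uv)).
  by rewrite leNgt wv.
congr _%:E; rewrite big_mkcond (bigD1_seq j) ?fset_uniq//= dj uj Hj.
rewrite big_seq_cond big1 ?addr0// => l /andP[lI lj].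
by rewrite Hj0//; case: ifP.
Qed.

(** All jobs have density above 0. The busy period for threshold 0 ending at [T] is no longer than
    the total size, so for this large [T] it starts after every release, and all jobs are
    finished. *)
Lemma hdf_completes : completes I H.
Proof.
pose T := \sum_(j <- jobs I) (rel I j + proc I j) + 1.
have sumT : forall l, l \in jobs I ->
    rel I l + \sum_(j <- jobs I) proc I j < T.
  move=> l lI; rewrite /T big_split/=.
  have : rel I l <= \sum_(j <- jobs I) rel I j.
    rewrite (bigD1_seq l) ?fset_uniq//= lerDl big_seq_cond sumr_ge0//.
    by move=> j /andP[/rel_ge0].
  lra.
move=> l lI; exists T; split.
  have := sumT _ lI; have : 0 <= \sum_(j <- jobs I) proc I j.
    by rewrite big_seq_cond sumr_ge0// => j /andP[/proc_gt0/ltW].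
  lra.
rewrite (work_rwork HP)//; congr _%:E; apply/le_anti; rewrite rwork_le_proc//=.
have [u [uT fin busy]] := hdf_busy 0 T; apply: fin => //.
  by rewrite divr_gt0 ?wt_gt0 ?proc_gt0.
have : T - u <= \sum_(j <- jobs I) proc I j.
  rewrite -busy big_seq_cond [leRHS]big_seq_cond big_mkcond [leRHS]big_mkcond/=.
  apply: ler_sum => j _; case: (boolP (j \in jobs I)) => jI //=.
  by case: ifP => // _; [exact: rwork_le_proc|exact/ltW/proc_gt0].
by have := sumT _ lI; lra.
Qed.

End HDFSchedule.

(** * HDF against a schedule of speed [s]; the integral cost *)

Section Comparison.
Variables (R : realType) (I : instance R) (H x : nat -> R -> R) (s : R).
Hypotheses (HP : schedule 1 I H) (hdfH : forall t, hdf_at I H t).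
Hypothesis xP : schedule s I x.
Implicit Types (d t u v : R) (j : nat).

Lemma density_ge0 j : j \in jobs I -> 0 <= density I j.
Proof. by move=> jI; rewrite divr_ge0// ltW ?wt_gt0 ?proc_gt0. Qed.

(* At every time the jobs above a density threshold that HDF may not have
   finished were all released after the start [u] of a busy period, during
   which any schedule of speed [s] serves at most [s] times as much of them. *)
Lemma hdf_dominates t (a : nat -> R) :
  {in jobs I, forall j, a j <= proc I j - s * rwork I H j t} ->
  {in jobs I, forall j, proc I j <= rwork I H j t -> a j <= 0} ->
  \sum_(j <- jobs I) density I j * a j <=
  \sum_(j <- jobs I) density I j * Num.max 0 (proc I j - rwork I x j t).
Proof.
move=> aQ a0; rewrite -subr_ge0 -sumrB.
under eq_bigr do rewrite -mulrBr.
apply: (@threshold_sum_ge0 _ _ _ (density I)) => [d|j jI|//]; last first.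
  exact: density_ge0.
have [u [ut fin busy]] := hdf_busy HP hdfH d t.
rewrite (bigID (fun j => u <= rel I j))/= addr_ge0//; last first.
  rewrite big_seq_cond sumr_ge0// => j /and3P[jI dj]; rewrite -ltNge => ju.
  by rewrite subr_ge0 le_max a0// fin.
pose late j := (d < density I j) && (u <= rel I j).
have := @sum_rwork_le _ _ _ _ xP late u t ut.
move=> /(_ (fun j _ => fun h => proj2 (andP h))); rewrite -busy mulr_sumr.
rewrite -subr_ge0 -sumrB => /le_trans; apply.
rewrite big_seq_cond [leRHS]big_seq_cond; apply: ler_sum => j /andP[jI _].
have : proc I j - rwork I x j t <= Num.max 0 (proc I j - rwork I x j t).
  by rewrite le_max lexx orbT.
by have := aQ _ jI; lra.
Qed.

(** Since HDF never overprocesses, work at least [proc I j] is the equality that [completed_by]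
    requires. *)
Lemma before_completion j v : j \in jobs I ->
  v < completion_time I H j -> rwork I H j v < proc I j.
Proof.
move=> jI vC; rewrite ltNge; apply/negP => pv.
have [vr|rv] := leP v (rel I j).
  by move: pv; rewrite rwork_before// leNgt proc_gt0.
suff : completion_time I H j <= v by rewrite leNgt vC.
apply: ge_inf; first by exists (rel I j) => C [].
split; first exact: ltW.
rewrite (work_rwork HP)//; congr _%:E.
by apply/le_anti; rewrite pv (rwork_le_proc HP hdfH).
Qed.

Lemma after_completion j v : completes I x -> j \in jobs I ->
  completion_time I x j <= v -> proc I j <= rwork I x j v.
Proof.
move=> cx jI Cv; have iC : has_inf (completed_by I x j).
  by split; [exact: cx|exists (rel I j) => C []].
apply/ler_addgt0Pr => e e0; have s0 := speed_ge0 xP.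
(* Dividing by [s + 1] keeps the Lipschitz error below [e] and allows [s = 0]. *)
have e0' : 0 < e / (s + 1) by rewrite divr_gt0// ltr_wpDl.
have [C [rC wC] CC] := inf_adherent e0' iC.
have -> : proc I j = rwork I x j C by rewrite /rwork wC.
have [/(rwork_le xP jI)|/ltW vC] := leP C v; first by lra.
have := rwork_lip xP jI vC; have : s * (C - v) <= e.
  apply: (@le_trans _ _ (s * (e / (s + 1)))).
    rewrite ler_wpM2l//; rewrite /completion_time in Cv; lra.
  by rewrite mulrCA ler_piMr ?(ltW e0)// ler_pdivrMr ?ltr_wpDl//; lra.
lra.
Qed.

Lemma completion_ge0 y j : completes I y -> j \in jobs I ->
  0 <= completion_time I y j.
Proof.
move=> cy jI; apply: lb_le_inf; first exact: cy.
by move=> C [+ _]; exact/le_trans/rel_ge0.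
Qed.

Lemma hdf_integral_cost (g : R -> R) :
  (forall t, 0 <= t -> 0 <= g t) ->
  (forall u t, 0 <= u -> u <= t -> g u <= g t) ->
  s <= 1 -> completes I x ->
  (1 - s) * \sum_(j <- jobs I) wt I j * g (completion_time I H j) <=
  \sum_(j <- jobs I) wt I j * g (completion_time I x j).
Proof.
move=> g_ge0 g_mono s1 cx.
(* The completion times of both schedules form one tagged list, so that the sum above a threshold
   [v] is the weight [x] has left at [v] minus [1 - s] times the weight HDF has left. *)
pose k (i : bool * nat) := completion_time I (if i.1 then H else x) i.2.
pose c (i : bool * nat) := (if i.1 then - (1 - s) else 1) * wt I i.2.
pose r := [seq (true, j) | j <- jobs I] ++ [seq (false, j) | j <- jobs I].
have rI i : i \in r -> i.2 \in jobs I.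
  by rewrite mem_cat => /orP[] /mapP[j jI ->].
have k0 : {in r, forall i, 0 <= k i}.
  move=> [[] j] /rI jI; apply: completion_ge0 => //.
  exact: hdf_completes hdfH.
have : 0 <= \sum_(i <- r) g (k i) * c i.
  apply: (@threshold_sum_ge0 _ _ _ k) => [v|i /k0/g_ge0//|i l ir lr];
    last exact/g_mono/k0.
  rewrite big_cat !big_map/= /c /k/=.
  (* HDF does at most [proc I j] of a job, so [(1 - s) * proc I j] is admissible as [a j];
     multiplied by the density it is [(1 - s) * wt I j]. *)
  have := @hdf_dominates v
    (fun j => if v < completion_time I H j then (1 - s) * proc I j else 0).
  have s0 := speed_ge0 xP.
  have combine (a b c1 c2 : R) :
    a <= b -> - c1 <= a -> b <= c2 -> 0 <= c1 + c2 by lra.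
  move=> /(_ _ _)/combine; apply.
  - move=> j jI; case: ifP => [_|/negbT]; last first.
      by have := rwork_le_proc HP hdfH v jI; have := proc_gt0 jI; nra.
    by have := rwork_le_proc HP hdfH v jI; have := proc_gt0 jI; nra.
  - move=> j jI pj; case: ifP => // /(before_completion jI).
    by rewrite ltNge pj.
  - rewrite -sumrN big_mkcond/= big_seq_cond [leRHS]big_seq_cond.
    apply: ler_sum => j /andP[jI _]; have p0 := proc_gt0 jI.
    case: ifP => _; last by rewrite mulr0.
    by rewrite mulNr opprK /density mulrCA divfK ?gt_eqF.
  - rewrite [leRHS]big_mkcond/= big_seq_cond [leRHS]big_seq_cond.
    apply: ler_sum => j /andP[jI _]; have p0 := proc_gt0 jI.
    case: ltP => [_|Cv].
      rewrite mul1r -[leRHS](@divfK _ (proc I j)) ?gt_eqF//.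
      rewrite ler_wpM2l ?density_ge0// ge_max ltW//= gerBl.
      exact: rwork_ge0 xP _ _ jI.
    rewrite (@max_idPl _ _ 0 _ _) ?mulr0// subr_le0.
    exact: after_completion.
rewrite big_cat !big_map/= /c /k/= => cost0.
rewrite -subr_ge0; move: cost0; congr (0 <= _).
rewrite mulr_sumr addrC -sumrN.
by congr (_ + _); apply: eq_bigr => j _; ring.
Qed.

End Comparison.

(** * Layer-cake formula with a weight *)

Section LayerCake.
Variables (R : realType) (h f : R -> R).
Hypotheses (h0 : forall t, 0 <= h t) (mh : measurable_fun setT h).
Hypotheses (f0 : forall t, 0 <= f t) (mf : measurable_fun setT f).
Local Notation mu := (@lebesgue_measure R).
Local Open Scope classical_set_scope.

Let GR := measurableTypeR R.
Let F (p : GR * GR) := (\1_[set p : GR * GR | 0 <= p.2 < h p.1] p * f p.1)%:E.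

Let mF : measurable_fun setT F.
Proof.
pose S := [set p : GR * GR | 0 <= p.2 < h p.1].
have mS : measurable S.
  rewrite (_ : S = [set p | (0 <= p.2) = true] `&`
      [set p | (p.2 < h p.1) = true]).
    apply: measurableI; rewrite -[X in measurable X]setTI.
      have := @measurable_fun_ler _ (GR * GR)%type R setT (fun=> 0) snd.
      move=> /(_ (measurable_cst _) measurable_snd measurableT [set true]).
      exact.
    have := @measurable_fun_ltr _ (GR * GR)%type R setT snd (h \o fst).
    move=> /(_ measurable_snd (measurableT_comp mh measurable_fst)).
    by move=> /(_ measurableT [set true]); exact.
  by apply/seteqP; split => p /=; [move=> /andP[]|move=> [? ?]; exact/andP].
apply/measurable_EFinP; apply: measurable_funM; first exact: measurable_indic.
exact: measurableT_comp mf measurable_fst.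
Qed.

Let F0 p : (0 <= F p)%E.
Proof. by rewrite lee_fin mulr_ge0// indicE. Qed.

Lemma measurable_layer : measurable_fun setT
  (fun y : R => \int[mu]_t (\1_[set t | 0 <= y < h t] t * f t)%:E)%E.
Proof. exact: (@measurable_fun_fubini_tonelli_G _ _ _ _ R mu F mF F0). Qed.

(** The value [h t] is the length of [[0, h t[]; Tonelli then exchanges the integrals over the
    region under the graph of [h]. *)
Lemma layer_cake : (\int[mu]_t (h t * f t)%:E =
  \int[mu]_y \int[mu]_t (\1_[set t | 0 <= y < h t] t * f t)%:E)%E.
Proof.
transitivity (\int[mu]_t \int[mu]_y F (t, y))%E; last first.
  by rewrite (fubini_tonelli F).
apply: eq_integral => t _.
transitivity (\int[mu]_y ((f t)%:E * (\1_(`[0, h t[) y)%:E))%E.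
  rewrite ge0_integralZl_EFin//=; last first.
    by apply/measurable_EFinP; exact: measurable_indic.
  rewrite integral_indic//= setIT lebesgue_measure_itv/= lte_fin.
  have [ht|ht] := ltP 0 (h t); first by rewrite -EFinB subr0 -EFinM mulrC.
  by rewrite (@le_anti _ _ (h t) 0) ?ht ?h0// mul0r mule0.
by apply: eq_integral => y _; rewrite -EFinM mulrC /F !indicE/= !mem_setE.
Qed.

End LayerCake.

(** * Optimality for the fractional cost *)

Section FractionalCost.
Variables (R : realType) (I : instance R).
Local Notation mu := (@lebesgue_measure R).
Local Open Scope classical_set_scope.

(** The speed at which fractional weight is processed. *)
Definition weighted_rate (x : nat -> R -> R) (t : R) : R :=
  \sum_(j <- jobs I) density I j * x j t.

Lemma weighted_rate_ge0 s x t : schedule s I x -> 0 <= weighted_rate x t.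
Proof.
move=> xP; rewrite /weighted_rate big_seq_cond sumr_ge0// => j /andP[jI _].
by rewrite mulr_ge0 ?density_ge0// (rate_ge0 xP).
Qed.

Let rate0 (x : nat -> R -> R) j t := if j \in jobs I then x j t else 0.

Lemma weighted_rateE x t :
  weighted_rate x t = \sum_(j <- jobs I) density I j * rate0 x j t.
Proof. by apply: eq_big_seq => j jI; rewrite /rate0 jI. Qed.

Lemma measurable_rate0 s x j (D : set R) : measurable D -> schedule s I x ->
  measurable_fun D (rate0 x j).
Proof.
move=> mD xP; rewrite /rate0.
case: (boolP (j \in jobs I)) => jI; last exact: measurable_cst.
by apply/measurable_EFinP; exact: (measurable_rate xP).
Qed.

Lemma measurable_weighted_rate s x : schedule s I x ->
  measurable_fun setT (weighted_rate x).
Proof.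
move=> xP; rewrite (funext (weighted_rateE x)).
apply: measurable_sum => j; apply: measurable_funM; first exact: measurable_cst.
exact: measurable_rate0 xP.
Qed.

Lemma integral_weighted_rate s x (h : R -> R) (D : set R) : measurable D ->
  measurable_fun D h -> (forall t, 0 <= h t) -> schedule s I x ->
  (\int[mu]_(t in D) (h t * weighted_rate x t)%:E =
   \sum_(j <- jobs I)
     (density I j)%:E * \int[mu]_(t in D) (h t * x j t)%:E)%E.
Proof.
move=> mD mh h0 xP.
pose y j t := (density I j * (h t * rate0 x j t))%:E.
have mhx j : measurable_fun D (fun t => h t * rate0 x j t).
  by apply: measurable_funM => //; exact: measurable_rate0 xP.
transitivity (\int[mu]_(t in D) (\sum_(j <- jobs I) y j t)%E)%E.
  apply: eq_integral => t _; rewrite weighted_rateE mulr_sumr -sumEFin.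
  by apply: eq_bigr => j _; rewrite /y mulrCA.
rewrite ge0_integral_sum//.
- apply: eq_big_seq => j jI; have := mhx j; rewrite /y /rate0 jI => mhxj.
  rewrite -ge0_integralZl_EFin// ?density_ge0//.
  + by move=> t _; rewrite lee_fin mulr_ge0// (rate_ge0 xP).
  + exact/measurable_EFinP.
- move=> j; apply/measurable_EFinP.
  by apply: measurable_funM; [exact: measurable_cst|exact: mhx].
- move=> j t _; rewrite /y /rate0 lee_fin.
  case: (boolP (j \in jobs I)) => jI; last by rewrite !mulr0.
  by rewrite mulr_ge0 ?density_ge0// mulr_ge0// (rate_ge0 xP).
Qed.

(** Rates vanish at negative times, so [g] may be frozen at [g 0] there; it becomes monotone on the
    whole line, hence measurable. *)
Lemma frac_costE (g : R -> R) s x :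
  (forall t, 0 <= t -> 0 <= g t) ->
  (forall u t, 0 <= u -> u <= t -> g u <= g t) -> schedule s I x ->
  frac_cost g I x = (\int[mu]_t (g (Num.max 0 t) * weighted_rate x t)%:E)%E.
Proof.
move=> g_ge0 g_mono xP; rewrite (@integral_weighted_rate s)//.
- rewrite /frac_cost; apply: eq_big_seq => j jI; congr (_ * _)%E.
  rewrite (frac_integralE xP)//; apply: eq_integral => t _.
  have [//|t0] := leP 0 t; suff -> : x j t = 0 by rewrite !mulr0.
  case: xP => _ _ + _; apply => //.
  exact: (lt_le_trans t0 (rel_ge0 jI)).
- apply: nondecreasing_measurable => // a b ab.
  apply: g_mono; first by rewrite le_max lexx.
  by rewrite ge_max !le_max lexx ab orbT.
- by move=> t; rewrite g_ge0 ?le_max ?lexx.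
Qed.

(** Only an inequality, because [x] may process a job beyond its size. *)
Lemma tail_rate_ge s x j t : schedule s I x -> completes I x ->
  j \in jobs I ->
  ((Num.max 0 (proc I j - rwork I x j t))%:E
    <= \int[mu]_(u in `]t, +oo[) (x j u)%:E)%E.
Proof.
move=> xP cx jI; have [C [_ wC]] := cx _ jI.
have tM : t <= Num.max t C by rewrite le_max lexx.
have CM : C <= Num.max t C by rewrite le_max lexx orbT.
rewrite EFin_max ge_max (integral_rate_ge0 xP)//=.
apply: (@le_trans _ _ (\int[mu]_(u in `]t, Num.max t C]) (x j u)%:E)%E).
  rewrite EFinB leeBlDl// -(rwork_split xP jI tM) lee_fin.
  by apply: le_trans (rwork_le xP jI CM); rewrite /rwork wC.
apply: ge0_subset_integral => //=.
- exact: (measurable_rate xP).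
- by move=> u _; rewrite lee_fin (rate_ge0 xP).
- by move=> u /=; rewrite !in_itv/= => /andP[->].
Qed.

Lemma hdf_tail_rate_le H j t : schedule 1 I H ->
  (forall t, hdf_at I H t) -> j \in jobs I ->
  (\int[mu]_(u in `]t, +oo[) (H j u)%:E <= (proc I j - rwork I H j t)%:E)%E.
Proof.
move=> HP hdfH jI; have [C [_ wC]] := hdf_completes HP hdfH jI.
set M := Num.max t C.
have tM : t <= M by rewrite le_max lexx.
have CM : C <= M by rewrite le_max lexx orbT.
have -> : `]t, +oo[ = `]t, M] `|` `]M, +oo[ :> set R.
  by rewrite -itv_bndbnd_setU// bnd_simp.
rewrite ge0_integral_setU//=.
- rewrite [X in (_ + X)%E]integral0_eq ?adde0 => [|u].
    rewrite EFinB leeBrDl// -(rwork_split HP jI tM) lee_fin.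
    exact: rwork_le_proc HP hdfH _ _ jI.
  rewrite /= in_itv/= andbT => /ltW Mu; rewrite (hdf_idle hdfH)//.
  rewrite (pendingE HP) jI /= negb_and -!leNgt; apply/orP; right.
  apply: le_trans (rwork_le HP jI (le_trans CM Mu)).
  by rewrite /rwork wC.
- by apply: (measurable_rate HP) => //; exact: measurableU.
- by move=> u _; rewrite lee_fin (rate_ge0 HP).
- apply/disj_setPS => u/= []; rewrite !in_itv/= andbT => /andP[_ uM].
  by rewrite ltNge uM.
Qed.

(** The tail integral is at most the fractional weight remaining at [t] for HDF, and at least that
    for [x]; [hdf_dominates] with [s = 1] compares the two. *)
Lemma hdf_tail_dominated H x t : schedule 1 I H ->
  (forall t, hdf_at I H t) -> schedule 1 I x -> completes I x ->
  (\int[mu]_(u in `]t, +oo[) (weighted_rate H u)%:E <=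
   \int[mu]_(u in `]t, +oo[) (weighted_rate x u)%:E)%E.
Proof.
move=> HP hdfH xP cx.
have E y : schedule 1 I y ->
    (\int[mu]_(u in `]t, +oo[) (weighted_rate y u)%:E =
     \sum_(j <- jobs I)
       (density I j)%:E * \int[mu]_(u in `]t, +oo[) (y j u)%:E)%E.
  move=> yP; have := @integral_weighted_rate 1 y (cst 1) `]t, +oo[.
  under eq_integral do rewrite /= mul1r.
  move=> ->//; apply: eq_bigr => j _; congr (_ * _)%E.
  by apply: eq_integral => u _; rewrite mul1r.
rewrite !E//; apply: (@le_trans _ _
    (\sum_(j <- jobs I) density I j * (proc I j - rwork I H j t))%:E).
  rewrite -sumEFin big_seq [leRHS]big_seq; apply: lee_sum => j jI.
  rewrite [leRHS]EFinM; apply: lee_wpmul2l; last exact: hdf_tail_rate_le.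
  by rewrite lee_fin density_ge0.
apply: (@le_trans _ _ (\sum_(j <- jobs I)
    density I j * Num.max 0 (proc I j - rwork I x j t))%:E).
  rewrite lee_fin; apply: (hdf_dominates HP hdfH xP) => j jI /=.
    by rewrite mul1r.
  by rewrite subr_le0.
rewrite -sumEFin big_seq [leRHS]big_seq; apply: lee_sum => j jI.
rewrite [leLHS]EFinM; apply: lee_wpmul2l; last exact: (tail_rate_ge _ xP).
by rewrite lee_fin density_ge0.
Qed.

Lemma hdf_frac_cost_le (g : R -> R) H x :
  (forall t, 0 <= t -> 0 <= g t) ->
  (forall u t, 0 <= u -> u <= t -> g u <= g t) -> g 0 = 0 ->
  schedule 1 I H -> (forall t, hdf_at I H t) ->
  schedule 1 I x -> completes I x ->
  (frac_cost g I H <= frac_cost g I x)%E.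
Proof.
move=> g_ge0 g_mono g0 HP hdfH xP cx.
rewrite (frac_costE g_ge0 g_mono HP) (frac_costE g_ge0 g_mono xP).
pose h (t : R) := g (Num.max 0 t).
have h_ge0 t : 0 <= h t by rewrite g_ge0 ?le_max ?lexx.
have h_mono a b : a <= b -> h a <= h b.
  move=> ab; apply: g_mono; first by rewrite le_max lexx.
  by rewrite ge_max !le_max lexx ab orbT.
have mh : measurable_fun setT h by apply: nondecreasing_measurable => // a b.
have mH := measurable_weighted_rate HP.
have mx := measurable_weighted_rate xP.
have H0 t := weighted_rate_ge0 t HP.
have x0 t := weighted_rate_ge0 t xP.
rewrite (layer_cake h_ge0 mh H0 mH) (layer_cake h_ge0 mh x0 mx).
have level (E : set R) (f : R -> R) :
    (\int[mu]_t (\1_E t * f t)%:E = \int[mu]_(t in E) (f t)%:E)%E.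
  rewrite [RHS]integral_mkcond; apply: eq_integral => t _.
  by rewrite patchE indicE; case: ifP; rewrite ?mul1r ?mul0r.
apply: ge0_le_integral => //=.
- move=> y _; apply: integral_ge0 => t _.
  by rewrite lee_fin mulr_ge0// indicE.
- exact: measurable_layer.
- exact: measurable_layer.
move=> y _.
rewrite !level.
have [[t0 /andP[y0 yt0]]|D0] := pselect (exists t0, 0 <= (y : R) < h t0);
  last first.
  rewrite (_ : [set t | _] = set0) ?integral_set0//.
  by apply/seteqP; split => // t yt; case: D0; exists t.
set D := [set t | _].
(* Here [g 0 = 0] keeps the level set away from negative times, so its infimum exists. *)
have D_ge0 t : D t -> 0 <= t.
  move=> /andP[_]; apply: contraTT; rewrite -ltNge -leNgt => tl0.
  by rewrite /h (max_idPl (ltW tl0)) g0.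
have iD : has_inf D.
  by split; [exists t0; apply/andP|exists 0 => t; exact: D_ge0].
have D_sub : D `<=` `[inf D, +oo[.
  by move=> t Dt /=; rewrite in_itv/= andbT; exact: (ge_inf iD.2).
have sub_D : `]inf D, +oo[ `<=` D.
  move=> t /=; rewrite in_itv/= andbT => /(inf_lt iD.1)[v /andP[_ yv] /ltW vt].
  by rewrite /D/= y0 (lt_le_trans yv)// h_mono.
have mD : measurable D.
  apply: is_interval_measurable => a b /andP[_ ya] _ c /andP[ac _].
  by rewrite /D/= y0 (lt_le_trans ya)// h_mono.
(* [D] lies between the open and the closed ray at [inf D], which differ by a null set. *)
apply: (@le_trans _ _ (\int[mu]_(u in `[inf D, +oo[) (weighted_rate H u)%:E)%E).
  apply: ge0_subset_integral => //=.
    by apply/measurable_EFinP; apply: measurable_funS mH.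
  by move=> u _; rewrite lee_fin.
rewrite -integral_itv_obnd_cbnd; last first.
  by apply/measurable_EFinP; apply: measurable_funS mH.
apply: (le_trans (hdf_tail_dominated _ HP hdfH xP cx)).
apply: ge0_subset_integral => //=.
  by apply/measurable_EFinP; apply: measurable_funS mx.
by move=> u _; rewrite lee_fin.
Qed.

End FractionalCost.

(** * Time slots left free by a busy set *)

Section Slot.
Variable R : realType.
Local Notation mu := (@lebesgue_measure R).
Local Open Scope classical_set_scope.
Implicit Types (r p t u v : R) (B : set R).

(** The first [p] units of time after [r] outside [B]. *)
Definition slot r p B : set R :=
  [set t | [/\ r <= t, ~ B t & (mu (`[r, t] `\` B) < p%:E)%E]].

Lemma measurable_itvD r t B : measurable B -> measurable (`[r, t] `\` B).
Proof. by move=> mB; exact: measurableD. Qed.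

Lemma le_free_time r u v B : measurable B -> u <= v ->
  (mu (`[r, u] `\` B) <= mu (`[r, v] `\` B))%E.
Proof.
move=> mB uv; rewrite le_measure ?inE//; try exact: measurable_itvD.
by apply: setSD; apply: subset_itvl; rewrite bnd_simp.
Qed.

Lemma measurable_slot r p B : measurable B -> measurable (slot r p B).
Proof.
move=> mB; rewrite (_ : slot r p B =
    (`[r, +oo[ `&` ~` B) `&` [set t | (mu (`[r, t] `\` B) < p%:E)%E]).
  apply: measurableI; first by apply: measurableI => //; exact: measurableC.
  apply: is_interval_measurable => a b _ /= lb c /andP[_ cb].
  exact: le_lt_trans (le_free_time _ mB cb) lb.
apply/seteqP; split => t /=; rewrite in_itv/= andbT.
  by move=> [].
by move=> [[]].
Qed.

(** Filling the slot tells whether [p] units of free time have elapsed, so being pending can be read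
    off [B]. If they have, the slot contains the free time before [sup E], which amounts to [p] by
    continuity. *)
Lemma slot_work r p t B : measurable B -> 0 < p -> r <= t ->
  (\int[mu]_(u in `[r, t]) (\1_(slot r p B) u)%:E < p%:E)%E =
  (mu (`[r, t] `\` B) < p%:E)%E.
Proof.
move=> mB p0 rt; have mX := measurable_slot r p mB.
rewrite integral_indic//.
apply/idP/idP; last first.
  apply: le_lt_trans; apply: le_measure; rewrite ?inE.
  - exact: measurableI.
  - exact: measurable_itvD.
  - by move=> u [[_ nB _] ut].
apply: contraTT; rewrite -!leNgt => pt.
pose E := [set v | [/\ r <= v, v <= t & (mu (`[r, v] `\` B) < p%:E)%E]].
have Er : E r.
  split=> //; apply: (@le_lt_trans _ _ (mu [set r])).
    by rewrite set_itv1; apply: le_measure; rewrite ?inE//; exact: measurableD.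
  by rewrite lebesgue_measure_set1 lte_fin.
have supE : has_sup E by split; [exists r|exists t => v []].
have Ec v : E v -> v <= sup E by exact: (ub_le_sup supE.2).
have rc := Ec _ Er.
have ct : sup E <= t by apply: ge_sup => [|v []//]; exists r.
have mc : measurable (`[r, sup E[ `\` B) by exact: measurableD.
apply: (@le_trans _ _ (mu (`[r, sup E[ `\` B))); last first.
  apply: le_measure; rewrite ?inE//; first exact: measurableI.
  move=> v [] /=; rewrite in_itv/= => /andP[rv vc] nB; split; last first.
    by rewrite /= in_itv/= rv (le_trans (ltW vc) ct).
  have /sup_adherent/(_ supE) : 0 < sup E - v by rewrite subr_gt0.
  rewrite subKr => -[a [_ _ lap] va]; split => //.
  exact: le_lt_trans (le_free_time _ mB (ltW va)) lap.
apply/lee_addgt0Pr => e e0.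
(* At [v], at most [e] past [sup E], the free time has reached [p]: either [v = t], or [v] exceeds
   [sup E] and so is not in [E]. *)
pose v := Num.min t (sup E + e).
have cv : sup E <= v by rewrite le_min ct lerDl ltW.
have pv : (p%:E <= mu (`[r, v] `\` B))%E.
  rewrite /v; case: (leP t (sup E + e)) => // cet.
  rewrite leNgt; apply/negP => vp.
  have /Ec : E (sup E + e).
    by split=> //; [rewrite (le_trans rc)// lerDl|]; exact: ltW.
  by rewrite leNgt ltrDl e0.
apply: (le_trans pv).
apply: (@le_trans _ _ (mu ((`[r, sup E[ `\` B) `|` `[sup E, v]))).
  apply: le_measure; rewrite ?inE//; first exact: measurable_itvD.
    exact: measurableU.
  move=> u [] /=; rewrite !in_itv/= => /andP[ru uv] nB.
  have [uc|cu] := ltP u (sup E); first by left; rewrite ru.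
  by right; rewrite uv.
have mcv : measurable `[sup E, v] by [].
have short : (mu `[sup E, v] <= e%:E)%E.
  rewrite lebesgue_measure_itv/=; case: ifP => _; last by rewrite lee_fin ltW.
  by rewrite -EFinB lee_fin lerBlDl ge_min lexx orbT.
apply: le_trans (leeD2l _ short); exact: measureU2.
Qed.

End Slot.

(** * Existence of an online HDF algorithm *)

Section PriorityFamily.
Variable R : realType.
Local Notation mu := (@lebesgue_measure R).
Local Open Scope classical_set_scope.
Implicit Types (I : instance R) (X : nat -> set R) (t : R) (i j : nat).

(* Ties in density are broken by the label, which makes the order strict and
   total. *)
Definition priority I i j : bool :=
  (i \in jobs I) && ((density I j < density I i) ||
    ((density I j == density I i) && (i < j)%N)).

Lemma priority_trans I i j l :
  priority I i j -> priority I j l -> priority I i l.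
Proof.
move=> /andP[iI ij] /andP[_ jl]; rewrite /priority iI /=.
move: ij jl => /orP[ij|/andP[/eqP ij nij]] /orP[jl|/andP[/eqP jl njl]].
- by rewrite (lt_trans jl ij).
- by rewrite jl ij.
- by rewrite -ij jl.
- by rewrite jl ij eqxx (ltn_trans nij njl) orbT.
Qed.

Lemma priority_irr I i : priority I i i = false.
Proof. by rewrite /priority ltxx ltnn andbF andbF. Qed.

Lemma priority_total I i j : i \in jobs I -> j \in jobs I -> i != j ->
  priority I i j || priority I j i.
Proof.
move=> iI jI; rewrite /priority iI jI/= neq_ltn.
by case: ltgtP => //= _ /orP[->|->]; rewrite ?orbT.
Qed.

Definition rank I j := #|` [fset l in jobs I | priority I l j]%fset|.

Lemma rank_lt I i j : priority I i j -> (rank I i < rank I j)%N.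
Proof.
move=> pij; apply: fproper_ltn_card; rewrite fproperE; apply/andP; split.
  apply/fsubsetP => l; rewrite !inE/= => /andP[-> li].
  exact: priority_trans pij.
apply/fsubsetPn; exists i; rewrite !inE/= ?priority_irr ?andbF// pij andbT.
by case/andP: pij.
Qed.

Definition busy I X j : set R := \bigcup_(i in [set i | priority I i j]) X i.

Definition priority_slots I X j : set R :=
  slot (rel I j) (proc I j) (busy I X j).

(* The recursion follows the priority order, hence stabilizes at [j] after
   [rank I j] steps. *)
Lemma priority_family_exists I : exists X, forall j, X j = priority_slots I X j.
Proof.
pose F n := iter n (priority_slots I) (fun=> set0).
have stable n : forall j, (rank I j < n)%N -> F n.+1 j = F n j.
  elim: n => // n IH j jn.
  change (slot (rel I j) (proc I j) (busy I (F n.+1) j) =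
          slot (rel I j) (proc I j) (busy I (F n) j)).
  congr slot; apply: eq_bigcupr => i /rank_lt ij; apply: IH.
  exact: leq_trans ij _.
exists (F (#|` jobs I|).+1) => j; rewrite -[LHS]stable// ltnS.
by apply/fsubset_leq_card/fsubsetP => l; rewrite !inE => /andP[].
Qed.

Lemma measurable_family I X j : (forall j, X j = priority_slots I X j) ->
  measurable (X j).
Proof.
move=> EX; have [n] := ubnP (rank I j); elim: n j => // n IH j jn.
rewrite EX; apply: measurable_slot; apply: bigcup_measurable => i ij.
by apply: IH; exact: leq_trans (rank_lt ij) jn.
Qed.

(** Induction on rank: up to [t], the slot of [j] depends only on the slots of higher priority, and
    one meeting times up to [t] belongs to a job revealed by [t], with the same data in both
    instances. *)
Lemma family_online I I' X X' t j v : same_history t I I' ->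
  (forall j, X j = priority_slots I X j) ->
  (forall j, X' j = priority_slots I' X' j) ->
  revealed I t j -> v <= t -> X j v <-> X' j v.
Proof.
move=> hist EX EX'.
have before Y J i u : (forall j, Y j = priority_slots J Y j) -> i \in jobs J ->
    Y i u -> u <= t -> revealed J t i.
  move=> EY iJ; rewrite EY => -[ru _ _] ut.
  by rewrite /revealed iJ (le_trans ru).
have same_priority i l : revealed I t i -> revealed I t l ->
    priority I i l = priority I' i l.
  move=> ri rl; have [ri' /(_ ri)[_ pi wi]] := hist i.
  have [_ /(_ rl)[_ pl wl]] := hist l.
  rewrite /priority /density pi wi pl wl.
  have -> : i \in jobs I by case/andP: ri.
  by move: ri; rewrite ri' => /andP[-> _].
have [n] := ubnP (rank I j); elim: n j v => // n IH j v jn rj vt.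
have busyE u : u <= t -> busy I X j u <-> busy I' X' j u.
  move=> ut; split=> -[i /= pij Xi].
    have ri := before _ _ _ _ EX (proj1 (andP pij)) Xi ut.
    exists i; first by rewrite /= -same_priority.
    by apply/(IH i u _ ri ut) => //; exact: leq_trans (rank_lt pij) jn.
  have ri : revealed I t i.
    by rewrite (hist i).1; exact: before EX' (proj1 (andP pij)) Xi ut.
  have pij' : priority I i j by rewrite same_priority.
  exists i => //.
  by apply/(IH i u _ ri ut) => //; exact: leq_trans (rank_lt pij') jn.
have [_ /(_ rj)[rE pE _]] := hist j.
rewrite EX EX' /priority_slots /slot/= -rE -pE.
have -> : `[rel I j, v] `\` busy I X j = `[rel I j, v] `\` busy I' X' j.
  apply/seteqP; split=> u [] /=; rewrite in_itv/= => /andP[ru uv] nB.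
    split; first by rewrite ru.
    by move=> Bu; apply/nB/(busyE _ (le_trans uv vt)).
  split; first by rewrite ru.
  by move=> Bu; apply/nB/(busyE _ (le_trans uv vt)).
by split=> -[rv nB ?]; split=> // Bv; apply/nB/(busyE _ vt).
Qed.

Section Schedule.
Variables (I : instance R) (X : nat -> set R).
Hypothesis EX : forall j, X j = priority_slots I X j.
Let x j t : R := \1_(X j) t.

Let free j t : bool :=
  (mu (`[rel I j, t] `\` busy I X j) < (proc I j)%:E)%E.

Let pending_free j t : j \in jobs I -> pending I x t j =
  (rel I j <= t) && free j t.
Proof.
move=> jI; rewrite /pending /revealed jI/= /free.
case: (leP (rel I j) t) => //= rt; rewrite /work /x.
under eq_integral do rewrite EX.
rewrite slot_work ?proc_gt0//.
by apply: bigcup_measurable => i _; exact: measurable_family.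
Qed.

Let memX j t : j \in jobs I ->
  X j t <-> pending I x t j /\ ~ busy I X j t.
Proof.
move=> jI; rewrite EX pending_free// /free.
split=> [[rt nB wp]|[/andP[rt wp] nB]] //.
by split=> //; rewrite rt wp.
Qed.

Lemma family_hdf t : hdf_at I x t.
Proof.
have [[j pj]|none] := pselect (exists j, pending I x t j); last first.
  right=> i iI; have npi : ~~ pending I x t i.
    by apply/negP => pi; apply: none; exists i.
  split=> //; rewrite /x indicE memNset// => /(memX _ iI)[pi _].
  by rewrite pi in npi.
left.
(* Descent on rank reaches a pending job that no pending job precedes. *)
have [j0 [pj0 top]] : exists j0, pending I x t j0 /\
    forall i, pending I x t i -> ~~ priority I i j0.
  have [n] := ubnP (rank I j); elim: n j pj => // n IH j pj jn.
  have [[i [pi pij]]|top] :=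
    pselect (exists i, pending I x t i /\ priority I i j).
    by apply: IH pi _; exact: leq_trans (rank_lt pij) jn.
  by exists j; split=> // i pi; apply/negP => pij; apply: top; exists i.
have jI i : pending I x t i -> i \in jobs I by move=> /andP[/andP[]].
have j0I := jI _ pj0.
(* A job of higher priority occupying [t] would be pending, against the choice of [j0]. *)
have Xj0 : X j0 t.
  apply/memX => //; split=> // -[i /= pij /(memX _ (proj1 (andP pij)))[pi _]].
  by move: (top _ pi); rewrite pij.
exists j0; split=> // [i pi||i iI ij0].
- have := top _ pi; rewrite /priority jI//= negb_or -leNgt.
  by case/andP.
- by rewrite /x indicE mem_set.
- rewrite /x indicE memNset// => /(memX _ iI)[pi]; apply.
  exists j0 => //=; have := priority_total iI j0I ij0.
  by rewrite (negbTE (top _ pi)).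
Qed.

Lemma family_schedule : schedule 1 I x.
Proof.
split=> [j jI|j t jI|j t jI tr|t].
- by apply: measurable_indic; exact: measurable_family.
- by rewrite /x indicE.
- rewrite /x indicE memNset// EX => -[+ _ _].
  by rewrite leNgt tr.
- case: (family_hdf t) => [[j [/andP[/andP[jI _] _] _ xj x0]]|idle].
    rewrite (bigD1_seq j) ?fset_uniq//= xj big_seq_cond big1 ?addr0//.
    by move=> i /andP[iI ij]; exact: x0.
  by rewrite big_seq big1// => i /idle[].
Qed.

End Schedule.

Lemma hdf_exists : exists A : instance R -> nat -> R -> R,
  online_algorithm A /\ HDF A.
Proof.
have [X EX] := choice priority_family_exists.
exists (fun I j t => \1_(X I j) t); split; last first.
  by move=> I t; exact: family_hdf.
split=> [I|I I' t hist j rj]; first exact: family_schedule.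
rewrite !indicE; congr (_%:R); congr nat_of_bool.
have E := family_online hist (EX I) (EX I') rj (lexx t).
by apply/idP/idP => /set_mem/E; exact: mem_set.
Qed.

End PriorityFamily.

Theorem theorem7 (R : realType) (g : R -> R)
  (g_ge0 : forall t : R, 0 <= t -> 0 <= g t)
  (g_mono : forall s t : R, 0 <= s -> s <= t -> g s <= g t)
  (g0 : g 0 = 0) :
  (exists A : instance R -> nat -> R -> R, online_algorithm A /\ HDF A) /\
  (forall A : instance R -> nat -> R -> R, online_algorithm A -> HDF A ->
     optimal (frac_cost g) A /\
     (forall eps : R, 0 < eps ->
        competitive (gct_cost g) (1 + eps) ((1 + eps) / eps) A)).
Proof.
split; first exact: hdf_exists.
move=> A [AP _] hdfA; split=> [I|eps e0 I]; have HP := AP I;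
  have cH := hdf_completes HP (hdfA I); split=> //.
  apply/le_anti/andP; split; last first.
    by apply: ereal_inf_lbound; exists (A I).
  apply: le_ereal_inf_tmp => _ [x [xP cx] <-].
  exact: (hdf_frac_cost_le g_ge0 g_mono g0 HP (hdfA I) xP cx).
have e1 : 0 < 1 + eps by lra.
rewrite muleC -lee_pdivrMr ?divr_gt0//.
apply: le_ereal_inf_tmp => _ [x [xP cx] <-].
(* With [s = (1 + eps)^-1], the factor [1 - s] is [eps / (1 + eps)], the inverse of the competitive
   ratio. *)
have s1 : (1 + eps)^-1 <= 1 by rewrite invf_le1//; lra.
have := hdf_integral_cost HP (hdfA I) xP g_ge0 g_mono s1 cx.
rewrite /gct_cost -EFinM lee_fin; congr (_ <= _).
by rewrite mulrC; congr (_ * _); field; rewrite !gt_eqF.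
Qed.
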